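(* Fix $\alpha\in(0,1)$. As $\theta\to\infty$, the family of distributions $\{GEM(\theta,\alpha):\theta>0\}$ satisfies a large deviation principle on $\mathcal{E}$ with speed $\theta$ and rate function \[ S(x_1,x_2,\ldots)=\begin{cases}\log\dfrac{1}{1-\sum_{i=1}^{\infty}x_i}, & \sum_{i=1}^{\infty}x_i<1,\\[2mm] \infty, & \text{otherwise.}\end{cases} \]
   Context: $E=[0,1]$, $E^{\infty}$ is the countably infinite Cartesian product of $E$ with the product topology (metrized by $|{\bf u}-{\bf v}|=\sum_{i\ge1}|u_i-v_i|/2^i$), and $\mathcal{E}=\{(x_1,x_2,\ldots)\in E^{\infty}:\sum_{k=1}^{\infty}x_k\le 1\}$ with the subspace topology (a compact space). For $\theta>0$ and $\alpha\in(0,1)$, let $U_1,U_2,\ldots$ be independent random variables such that $U_k$ has the $Beta(1-\alpha,\theta+k\alpha)$ distribution, and set $X_1^{\theta,\alpha}=U_1$, $X_n^{\theta,\alpha}=(1-U_1)\cdots(1-U_{n-1})U_n$ for $n\ge 2$. $GEM(\theta,\alpha)$ is the law of $(X_1^{\theta,\alpha},X_2^{\theta,\alpha},\ldots)$ on $\mathcal{E}$ (almost surely $\sum_k X_k^{\theta,\alpha}=1$). A family of probability measures $\{Q_\theta:\theta>0\}$ on a topological space $\mathcal{X}$ satisfies a large deviation principle (as $\theta\to\infty$) with speed $\theta$ and rate function $I:\mathcal{X}\to[0,\infty]$ if $I$ is lower semicontinuous, $\limsup_{\theta\to\infty}\frac1\theta\log Q_\theta(F)\le-\inf_{x\in F}I(x)$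 for every closed $F\subset\mathcal{X}$, and $\liminf_{\theta\to\infty}\frac1\theta\log Q_\theta(G)\ge-\inf_{x\in G}I(x)$ for every open $G\subset\mathcal{X}$. *)

(* Defs.v *)
From HB Require Import structures.
From mathcomp Require Import all_boot all_order all_algebra finmap.
From mathcomp Require Import all_classical all_reals all_analysis.

Set Implicit Arguments.
Unset Strict Implicit.
Unset Printing Implicit Defensive.

Import Order.TTheory GRing.Theory Num.Theory.
Import numFieldNormedType.Exports.

Local Open Scope classical_set_scope.
Local Open Scope ring_scope.

Definition borel (X : ptopologicalType) := g_sigma_algebraType (@open X).

HB.instance Definition _ (X : ptopologicalType) := Measurable.on (borel X).

(** LDP as the real index theta tends to +oo, with speed theta. Only the
    behaviour for large theta matters, so the values of [Q] at nonpositive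
    indices play no role. [lne 0 = -oo] and [ereal_inf set0 = +oo]. *)
Definition LDP (R : realType) (X : ptopologicalType)
    (Q : R -> probability (borel X) R) (I : X -> \bar R) : Prop :=
  [/\ (forall x, 0 <= I x)%E,
      lower_semicontinuous I,
      (forall F : set X, closed F ->
        limf_esup (fun theta : R => theta^-1%:E * lne (Q theta F))
          (pinfty_nbhs R) <= - ereal_inf (I @` F))%E
    & (forall G : set X, open G ->
        - ereal_inf (I @` G) <=
        limf_einf (fun theta : R => theta^-1%:E * lne (Q theta G))
          (pinfty_nbhs R))%E].

Definition unit_interval (R : realType) : set R := `[0, 1].
Arguments unit_interval : clear implicits.

(** A set coerced to a type carries the subspace topology and [{ptws _ -> _}]
    the product topology. *)
Definition cube (R : realType) := {ptws nat -> unit_interval R}.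

HB.instance Definition _ (R : realType) := Topological.on (cube R).

Definition cube_sum (R : realType) (x : cube R) : \bar R :=
  (\sum_(0 <= k <oo) (\val (x k))%:E)%E.

(** Coordinates are numbered from 0: [x k] stands for x_{k+1}. *)
Definition subsimplex_set (R : realType) : set (cube R) :=
  [set x | (cube_sum x <= 1)%E].
Arguments subsimplex_set : clear implicits.

Definition subsimplex (R : realType) : Type := subsimplex_set R.

HB.instance Definition _ (R : realType) :=
  Topological.copy (subsimplex R) (subsimplex_set R : Type).

Lemma unit_interval0 (R : realType) : (0 : R) \in unit_interval R.
Proof. by apply: mem_set; rewrite /unit_interval /= in_itv /= lexx ler01. Qed.

Definition cube0 (R : realType) : cube R := fun=> exist _ 0 (unit_interval0 R).

Lemma subsimplex_set0 (R : realType) : cube0 R \in subsimplex_set R.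
Proof.
by apply: mem_set; rewrite /subsimplex_set /= /cube_sum eseries0// lee01.
Qed.

HB.instance Definition _ (R : realType) :=
  isPointed.Build (subsimplex R) (exist _ (cube0 R) (subsimplex_set0 R)).

Definition coordinate (R : realType) (x : subsimplex R) (k : nat) : R :=
  \val (\val x k).

(** The library's [beta_fun], [beta_pdf], [beta_prob] only cover parameters in
    [nat]; here [a] and [b] are positive reals. *)
Definition Beta_weight (R : realType) (a b x : R) : R :=
  x `^ (a - 1) * (1 - x) `^ (b - 1).

Definition Beta_density (R : realType) (a b x : R) : R :=
  ((Beta_weight a b \_ `[0, 1]) x) /
  (\int[lebesgue_measure]_(y in `[0, 1]) Beta_weight a b y).

Definition has_Beta_law (R : realType) (d : measure_display)
    (T : measurableType d) (P : probability T R) (a b : R)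
    (U : {RV P >-> R}) : Prop :=
  forall A : set R, measurable A ->
    distribution P U A =
    (\int[lebesgue_measure]_(x in A) (Beta_density a b x)%:E)%E.

Definition mutually_independent (R : realType) (d : measure_display)
    (T : measurableType d) (P : probability T R)
    (U : nat -> {RV P >-> R}) : Prop :=
  forall (J : {fset nat}) (A : nat -> set R), (forall i, measurable (A i)) ->
    P (\bigcap_(i in [set` J]) (U i @^-1` A i)) =
    (\prod_(i <- J) P (U i @^-1` A i))%E.

Definition stick_breaking (R : realType) (T : Type) (U : nat -> T -> R)
    (n : nat) (t : T) : R :=
  (\prod_(i < n) (1 - U i t)) * U n t.

(** [mu] is GEM(theta, alpha). The Beta variables lie in [0, 1], and hence the
    stick-breaking sequence lies in the subsimplex, only almost surely, so the
    random element [X] of the subsimplex is required to be almost surely equal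
    to that sequence. With numbering from 0, [U k] is U_{k+1}. *)
Definition is_GEM (R : realType) (theta alpha : R)
    (mu : probability (borel (subsimplex R)) R) : Prop :=
  exists (d : measure_display) (T : measurableType d) (P : probability T R)
         (U : nat -> {RV P >-> R}) (X : {RV P >-> borel (subsimplex R)}),
    [/\ mutually_independent U,
        forall k, has_Beta_law (1 - alpha) (theta + k.+1%:R * alpha) (U k),
        {ae P, forall t, forall n,
          coordinate (X t) n = stick_breaking (fun k => U k : T -> R) n t}
      & forall A : set (subsimplex R), measurable (A : set (borel _)) ->
          mu A = distribution P X A].

Definition GEM_rate (R : realType) (x : subsimplex R) : \bar R :=
  let s := cube_sum (\val x) in
  if (s < 1)%E then (ln (1 / (1 - fine s)))%:E else +oo%E.

(* Main.v *)
Require Import Defs.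
From mathcomp Require Import all_boot all_order all_algebra finmap.
From mathcomp Require Import all_classical all_reals all_analysis.
From mathcomp Require Import measurable_realfun ring lra.

(** Why the theorem holds.

    Write X_1 + ... + X_n = 1 - (1 - U_1) ... (1 - U_n).  The law of U_k at
    parameter theta is its law at parameter 1 tilted by (1 - x)^(theta - 1)
    and renormalized: all the theta-dependence sits in that one power, and the
    normalizing constant lies between (1 - delta)^(theta - 1) times a constant
    and a constant, for every delta > 0.  So, on the scale exp(- c theta),
    1 - U_k being near r costs exactly r^theta ([Beta_law_tail] from above,
    [Beta_law_itv_ge] from below).  By independence the costs multiply, and
    prod_(k <= n) (1 - U_k) being near r costs r^theta however the factors
    share it; this is why the rate of a point depends on the sum of its
    coordinates only.

    Upper bound.  The rate exceeds c exactly when some partial sum exceeds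
    1 - exp(- c) ([GEM_rate_gtE]).  A closed F on which the rate exceeds c is
    compact, hence one n serves all of F ([closed_GEM_rate_gt]), and the
    probability of F is at most that of prod_(i < n) (1 - U_i) < exp(- c).
    Cutting the scale of - ln (1 - U_i) into steps of length h = c / m covers
    this event by finitely many products of tail events ([prod_lt_cover]);
    independence and [Beta_law_tail] bound each of them, with a total loss
    of 2 n h in the exponent that vanishes as m grows ([GEM_closed_le]).

    Lower bound.  A point x of an open G with finite rate is the
    stick-breaking sequence of some v_i < 1, and G contains a cylinder around
    x ([open_cylinder]).  If U_i lies in [v_i, v_i + del] for i < n, with del
    small, then X lies in that cylinder, because stick breaking is Lipschitz
    in each coordinate; the probability of this is of exponential order
    prod_(i < n) (1 - v_i - del)^theta, and prod_(i < n) (1 - v_i) is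
    1 - sum_(i < n) x_i, which is at least 1 - sum_i x_i ([GEM_open_ge]). *)

Set Implicit Arguments.
Unset Strict Implicit.
Unset Printing Implicit Defensive.

Import Order.TTheory GRing.Theory Num.Theory.
Import numFieldNormedType.Exports.

Local Open Scope classical_set_scope.
Local Open Scope ring_scope.

(** * Beta integrals under exponential tilting *)

Section BetaIntegral.
Variables (R : realType) (a : R).
Hypothesis (a_le1 : a <= 1).
Local Notation mu := (@lebesgue_measure R).

Definition Beta_integral (b : R) (A : set R) : \bar R :=
  (\int[mu]_(x in A) (Beta_weight a b x)%:E)%E.

Lemma Beta_weight_ge0 b x : 0 <= Beta_weight a b x.
Proof. by rewrite mulr_ge0 ?powR_ge0. Qed.

Lemma measurable_Beta_weight b (A : set R) : measurable_fun A (Beta_weight a b).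
Proof.
apply: (measurable_funS measurableT) => //.
apply: measurable_funM; first exact: measurable_powR.
apply: (measurableT_comp (measurable_powR _)).
exact: measurable_funB.
Qed.

Lemma measurable_Beta_weight_EFin b (A : set R) :
  measurable_fun A (fun x => (Beta_weight a b x)%:E).
Proof. by apply/measurable_EFinP; exact: measurable_Beta_weight. Qed.

Lemma Beta_integral_le b (A B : set R) :
  measurable A -> measurable B -> A `<=` B ->
  (Beta_integral b A <= Beta_integral b B)%E.
Proof.
move=> mA mB AB; apply: ge0_subset_integral => //.
  exact: measurable_Beta_weight_EFin.
by move=> x _; rewrite lee_fin Beta_weight_ge0.
Qed.

(** The second Beta parameter enters through a power of [1 - x], so raising it
    by [theta - 1] is a tilt. At [x = 1] the identity rests on [powR 0 r = 0]
    for nonzero [r]. *)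
Lemma Beta_weight_tilt theta beta x : 1 <= theta -> 0 < beta ->
  Beta_weight a (theta + beta) x =
  (1 - x) `^ (theta - 1) * Beta_weight a (1 + beta) x.
Proof.
move=> theta1 beta0; rewrite /Beta_weight mulrCA -powRD; last first.
  by apply/implyP => /eqP; lra.
by congr (_ * _ `^ _); lra.
Qed.

(** The tilting factor is at most its value at the left end of the interval,
    and in [ge_Beta_integral_tilt] at least its value at the right end. Writing
    the endpoint as [1 - expR (- c)] makes that value an exponential. *)
Lemma le_Beta_integral_tilt theta beta c (A : set R) :
  1 <= theta -> 0 < beta -> measurable A -> A `<=` `[1 - expR (- c), 1] ->
  (Beta_integral (theta + beta) A <=
   (expR (- c * (theta - 1)))%:E * Beta_integral (1 + beta) A)%E.
Proof.
move=> theta1 beta0 mA Ac; rewrite /Beta_integral -ge0_integralZl ?lee_fin ?expR_ge0//; last 2 first.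
- exact: measurable_Beta_weight_EFin.
- by move=> x _; rewrite lee_fin Beta_weight_ge0.
apply: ge0_le_integral => //.
- by move=> x _; rewrite lee_fin Beta_weight_ge0.
- exact: measurable_Beta_weight_EFin.
- by apply: measurable_funeM; exact: measurable_Beta_weight_EFin.
move=> x /Ac /=; rewrite in_itv/= => /andP[cx x1].
rewrite -EFinM lee_fin Beta_weight_tilt// ler_wpM2r ?Beta_weight_ge0//.
by rewrite expRM ge0_ler_powR// ?nnegrE ?expR_ge0 ?subr_ge0//; lra.
Qed.

Lemma ge_Beta_integral_tilt theta beta c (A : set R) :
  1 <= theta -> 0 < beta -> measurable A -> A `<=` `[0, 1 - expR (- c)] ->
  ((expR (- c * (theta - 1)))%:E * Beta_integral (1 + beta) A <=
   Beta_integral (theta + beta) A)%E.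
Proof.
move=> theta1 beta0 mA Ac; rewrite /Beta_integral -ge0_integralZl ?lee_fin ?expR_ge0//; last 2 first.
- exact: measurable_Beta_weight_EFin.
- by move=> x _; rewrite lee_fin Beta_weight_ge0.
apply: ge0_le_integral => //.
- by move=> x _; rewrite mule_ge0// lee_fin ?expR_ge0 ?Beta_weight_ge0.
- by apply: measurable_funeM; exact: measurable_Beta_weight_EFin.
- exact: measurable_Beta_weight_EFin.
move=> x /Ac /=; rewrite in_itv/= => /andP[x0 cx].
have := expR_gt0 (- c) => ec.
rewrite -EFinM lee_fin Beta_weight_tilt// ler_wpM2r ?Beta_weight_ge0//.
by rewrite expRM ge0_ler_powR// ?nnegrE ?expR_ge0 ?subr_ge0//; lra.
Qed.

Lemma Beta_integral_gt0 beta u v : 0 < beta -> 0 <= u -> u < v -> v <= 1 ->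
  (0 < Beta_integral (1 + beta) `[u, v])%E.
Proof.
move=> beta0 u0 uv v1.
(* stopping halfway keeps 1 - x, and hence the weight, away from 0 *)
set m := (u + v) / 2.
have um : u < m by rewrite /m; lra.
have mv : m < v by rewrite /m; lra.
apply: (@lt_le_trans _ _ (((1 - m) `^ beta)%:E * (m - u)%:E)%E).
  by rewrite mule_gt0// lte_fin ?powR_gt0 ?subr_gt0//; lra.
apply: (@le_trans _ _ (Beta_integral (1 + beta) `]u, m])); last first.
  apply: Beta_integral_le => // x /=; rewrite !in_itv/= => /andP[? ?].
  by apply/andP; split; lra.
have -> : (m - u)%:E = mu `]u, m] by rewrite lebesgue_measure_itv/= lte_fin um.
rewrite -integral_cst// /Beta_integral; apply: ge0_le_integral => //.
- by move=> x _; rewrite lee_fin powR_ge0.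
- exact: measurable_Beta_weight_EFin.
move=> x /=; rewrite in_itv/= => /andP[ux xm]; rewrite lee_fin /Beta_weight.
rewrite -[leLHS]mul1r ler_pM ?powR_ge0//; last first.
  rewrite (_ : 1 + beta - 1 = beta); last by lra.
  by rewrite ge0_ler_powR// ?nnegrE; lra.
(* x `^ (a - 1) >= 1, because a <= 1 and 0 < x <= 1 *)
rewrite /powR gt_eqF; last by lra.
rewrite -[leLHS]expR0 ler_expR; apply: mulr_le0; first by rewrite subr_le0.
by apply: ln_le0; lra.
Qed.

Lemma Beta_integral_itv_real beta u v :
  0 < beta -> 0 <= u -> u < v -> v <= 1 ->
  (Beta_integral (1 + beta) `[0%R, 1%R] < +oo)%E ->
  exists2 k : R, 0 < k & Beta_integral (1 + beta) `[u, v] = k%:E.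
Proof.
move=> beta0 u0 uv v1 Jfin.
have J0 := Beta_integral_gt0 beta0 u0 uv v1.
have Jle : (Beta_integral (1 + beta) `[u, v] <=
            Beta_integral (1 + beta) `[0%R, 1%R])%E.
  apply: Beta_integral_le => // x /=; rewrite !in_itv/= => /andP[? ?].
  by apply/andP; split; lra.
have JE : Beta_integral (1 + beta) `[u, v] =
          (fine (Beta_integral (1 + beta) `[u, v]))%:E.
  by rewrite fineK// ge0_fin_numE ?(ltW J0)// (le_lt_trans Jle).
by eexists; [|exact: JE]; rewrite -lte_fin -JE.
Qed.

End BetaIntegral.

(** * Exponential bounds for Beta laws *)

Section BetaLaw.
Variables (R : realType) (d : measure_display) (T : measurableType d).
Variables (P : probability T R) (a b : R) (U : {RV P >-> R}).
Hypothesis (UB : has_Beta_law a b U).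
Local Notation mu := (@lebesgue_measure R).

Lemma Beta_law_integral (A : set R) :
  measurable A -> A `<=` `[0, 1] ->
  P (U @^-1` A) = (Beta_integral a b A *
    ((\int[mu]_(y in `[0, 1]) Beta_weight a b y)^-1)%:E)%E.
Proof.
move=> mA A01; have := UB mA; rewrite /distribution/= /pushforward => ->.
rewrite muleC -ge0_integralZl//; last 3 first.
- exact: measurable_Beta_weight_EFin.
- by move=> x _; rewrite lee_fin Beta_weight_ge0.
- rewrite lee_fin invr_ge0; apply: Rintegral_ge0 => //.
  by move=> x _; rewrite Beta_weight_ge0.
apply: eq_integral => x /set_mem /A01 x01.
by rewrite /Beta_density patchE mem_set// -EFinM mulrC.
Qed.

Lemma Beta_law_support : P (U @^-1` (~` `[0, 1])) = 0%E.
Proof.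
have mC : measurable (~` `[0, 1] : set R) by exact: measurableC.
have := UB mC; rewrite /distribution/= /pushforward => ->.
apply: integral0_eq => x x01.
by rewrite /Beta_density patchE memNset// mul0r.
Qed.

(** The Beta integral converges because a probability has mass 1: if it were
    zero or infinite, the real-valued normalizing constant would be 0, the
    density would vanish, and so would the total mass. *)
Lemma Beta_law_normalization : exists2 z : R, 0 < z &
  Beta_integral a b `[0, 1] = z%:E /\
  forall A : set R, measurable A -> A `<=` `[0, 1] ->
    P (U @^-1` A) = (Beta_integral a b A * (z^-1)%:E)%E.
Proof.
set z := \int[mu]_(y in `[0, 1]) Beta_weight a b y.
have J1 : (Beta_integral a b `[0%R, 1%R] * (z^-1)%:E = 1)%E.
  rewrite -Beta_law_integral//.
  have : P (U @^-1` `[0, 1] `|` U @^-1` (~` `[0, 1])) = 1%E.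
    by rewrite -preimage_setU setUv preimage_setT probability_setT.
  rewrite measureU//.
  - move=> <-; rewrite -[LHS]adde0; congr (_ + _)%E; exact: esym Beta_law_support.
  - exact: measurable_funPTI.
  - by apply: measurable_funPTI; exact: measurableC.
  - by rewrite -preimage_setI setICr preimage_set0.
have z0 : z != 0.
  by apply/eqP => z0; move: J1; rewrite z0 invr0 mule0 => /eqP; rewrite eqe eq_sym oner_eq0.
have Jz : z = fine (Beta_integral a b `[0, 1]) by [].
have zge0 : 0 <= z.
  by apply: Rintegral_ge0 => // x _; exact: Beta_weight_ge0.
have zgt0 : 0 < z by rewrite lt_neqAle eq_sym z0.
exists z => //; split; last exact: Beta_law_integral.
have : Beta_integral a b `[0, 1] \is a fin_num.
  by move: Jz z0; case: (Beta_integral _ _ _) => // ->; rewrite eqxx.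
by move=> /fineK <-; rewrite -Jz.
Qed.

End BetaLaw.

(** The numerator of the tail probability is at most a constant times
    [expR (- c * (theta - 1))]; the normalizing constant is bounded below by
    what the interval [[0, 1 - expR (- h)]] contributes to it. The rate [c] is
    thus reached up to an arbitrarily small loss [h], with a constant that
    depends neither on [theta] nor on [c]. *)
Lemma Beta_law_tail (R : realType) (a beta h : R) :
  a <= 1 -> 0 < beta -> 0 < h -> (Beta_integral a (1 + beta) `[0%R, 1%R] < +oo)%E ->
  exists2 C : R, 0 < C & forall (theta c : R) (d : measure_display)
      (T : measurableType d) (P : probability T R) (U : {RV P >-> R}),
    1 <= theta -> 0 <= c -> has_Beta_law a (theta + beta) U ->
    (P (U @^-1` `[(1 - expR (- c))%R, 1%R]) <=
     (C * expR ((h - c) * (theta - 1)))%:E)%E.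
Proof.
move=> a1 beta0 h0 Jfin.
have eh : expR (- h) < 1 by rewrite expR_lt1; lra.
have e0 := expR_gt0 (- h).
have [K K0 KE] := Beta_integral_itv_real a1 beta0 (lexx 0) ltr01 (lexx 1) Jfin.
have [k k0 kE] : exists2 k : R, 0 < k &
    Beta_integral a (1 + beta) `[0, 1 - expR (- h)] = k%:E.
  by apply: Beta_integral_itv_real => //; lra.
exists (K / k); first by rewrite divr_gt0.
move=> theta c d T P U theta1 c0 UB.
have ec : expR (- c) <= 1 by rewrite expR_le1; lra.
have [z z0 [zE ->//]] := Beta_law_normalization UB; last first.
  by move=> x /=; rewrite !in_itv/= => /andP[? ?]; apply/andP; split; lra.
have zge : expR (- h * (theta - 1)) * k <= z.
  rewrite -lee_fin -zE EFinM -kE.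
  apply: (le_trans (ge_Beta_integral_tilt a theta1 beta0 _ (c := h) _)) => //.
  apply: Beta_integral_le => // x /=; rewrite !in_itv/= => /andP[? ?].
  by apply/andP; split; lra.
have Jc : (Beta_integral a (theta + beta) `[(1 - expR (- c))%R, 1%R] <=
           (expR (- c * (theta - 1)) * K)%:E)%E.
  apply: (le_trans (le_Beta_integral_tilt a theta1 beta0 _ (c := c) _)) => //.
  rewrite EFinM -KE lee_wpmul2l ?lee_fin ?expR_ge0//.
  apply: Beta_integral_le => // x /=; rewrite !in_itv/= => /andP[? ?].
  by apply/andP; split; lra.
apply: (le_trans (lee_wpmul2r _ Jc)); first by rewrite lee_fin invr_ge0 ltW.
rewrite -EFinM lee_fin ler_pdivrMr//.
rewrite (_ : (h - c) * (theta - 1) = - c * (theta - 1) - - h * (theta - 1)); last by lra.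
rewrite expRD expRN.
apply: le_trans (ler_wpM2l _ zge); last first.
  by rewrite !mulr_ge0 ?invr_ge0 ?expR_ge0 ?(ltW k0) ?(ltW K0).
set e1 := expR _; set e2 := expR _.
have e20 : e2 != 0 by rewrite gt_eqF ?expR_gt0.
by rewrite [leRHS](_ : _ = e1 * K)//; field; rewrite e20 gt_eqF.
Qed.

(** The numerator is at least a constant times the tilting factor at [v], and
    the normalizing constant is at most its value at [theta = 1]. *)
Lemma Beta_law_itv_ge (R : realType) (a beta u v : R) :
  a <= 1 -> 0 < beta -> 0 <= u -> u < v -> v < 1 ->
  (Beta_integral a (1 + beta) `[0%R, 1%R] < +oo)%E ->
  exists2 C : R, 0 < C & forall (theta : R) (d : measure_display)
      (T : measurableType d) (P : probability T R) (U : {RV P >-> R}),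
    1 <= theta -> has_Beta_law a (theta + beta) U ->
    ((C * expR (ln (1 - v) * (theta - 1)))%:E <= P (U @^-1` `[u, v]))%E.
Proof.
move=> a1 beta0 u0 uv v1 Jfin.
have [K K0 KE] := Beta_integral_itv_real a1 beta0 (lexx 0) ltr01 (lexx 1) Jfin.
have [k k0 kE] := Beta_integral_itv_real a1 beta0 u0 uv (ltW v1) Jfin.
exists (k / K); first by rewrite divr_gt0.
move=> theta d T P U theta1 UB.
have [z z0 [zE ->//]] := Beta_law_normalization UB; last first.
  by move=> x /=; rewrite !in_itv/= => /andP[? ?]; apply/andP; split; lra.
have zK : z <= K.
  rewrite -lee_fin -zE -KE.
  have := le_Beta_integral_tilt a theta1 beta0 (measurable_itv `[0, 1]) (c := 0).
  rewrite !oppr0 mul0r expR0 mul1e; apply => x /=; rewrite !in_itv/=.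
  by move=> /andP[? ?]; apply/andP; split; lra.
have v0 : 0 < 1 - v by lra.
have : (((expR (ln (1 - v) * (theta - 1)) * k)%:E <=
    Beta_integral a (theta + beta) `[u, v]))%E.
  have := ge_Beta_integral_tilt a theta1 beta0 (measurable_itv `[u, v])
            (c := - ln (1 - v)).
  rewrite opprK lnK ?posrE// kE EFinM; apply => x /=; rewrite !in_itv/=.
  by move=> /andP[? ?]; apply/andP; split; lra.
have zV0 : (0 <= (z^-1)%:E)%E by rewrite lee_fin invr_ge0 ltW.
move=> /(lee_wpmul2r zV0); apply: le_trans.
rewrite -EFinM lee_fin mulrC mulrA ler_wpM2l ?lef_pV2//.
by rewrite mulr_ge0 ?expR_ge0 ?ltW.
Qed.

(** * Topology of the subsimplex and the rate function *)

Section Subsimplex.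
Variable R : realType.
Implicit Types x y : subsimplex R.

Lemma coordinate_itv x k : 0 <= coordinate x k <= 1.
Proof.
by have := set_valP (\val x k); rewrite /unit_interval/= in_itv.
Qed.

Lemma coordinate_continuous k : continuous (fun x => coordinate x k).
Proof.
move=> x.
apply: (@continuous_comp _ _ _ (fun x : subsimplex R => \val x k) set_val); last first.
  exact: initial_continuous.
apply: (@continuous_comp _ _ _ (fun x : subsimplex R => (\val x : cube R)) (fun f : cube R => f k)).
  exact: initial_continuous.
exact: (@proj_continuous _ (fun=> unit_interval R) k).
Qed.

Lemma cvg_coordinate (y : nat -> subsimplex R) x :
  (forall k, (fun n => coordinate (y n) k) @ \oo --> coordinate x k) ->
  y @ \oo --> x.
Proof.
move=> yx A [_ [[B oB <-] Bx BA]].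
have : (fun n => \val (y n) : cube R) @ \oo --> (\val x : cube R).
  apply/(@pointwise_cvgP nat (unit_interval R)) => k /= C [_ [[D oD <-] Dx DC]].
  have := yx k; move=> /(_ D); rewrite nbhs_filterE.
  have nD : nbhs (coordinate x k) D by apply: open_nbhs_nbhs; split.
  move=> /(_ nD) yD.
  change (\forall n \near \oo, C (\val (y n) k)).
  have {}yD : \forall n \near \oo, D (coordinate (y n) k) by [].
  by apply: filterS yD => n Dn; exact: DC.
move=> /(_ B) h.
have nB : nbhs (\val x : cube R) B by apply: open_nbhs_nbhs; split.
have yB : \forall n \near \oo, B (\val (y n)) by exact: h nB.
change (\forall n \near \oo, A (y n)).
by apply: filterS yB => n Bn; exact: BA.
Qed.


(** If it failed, one could pick for each [n] a point outside [G] that agrees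
    with [x] up to [1 / (n + 1)] in the first [n] coordinates; these points
    converge to [x]. *)
Lemma open_cylinder (G : set (subsimplex R)) x : open G -> G x ->
  exists n, exists2 e : R, 0 < e & forall y,
    (forall k, (k < n)%N -> `|coordinate y k - coordinate x k| <= e) -> G y.
Proof.
move=> oG Gx; apply: contrapT => noG.
have /choice[y yP] : forall n : nat, exists y : subsimplex R,
    (forall k, (k < n)%N -> `|coordinate y k - coordinate x k| <= n.+1%:R^-1)
    /\ ~ G y.
  move=> n; apply: contrapT => noy; apply: noG; exists n, n.+1%:R^-1.
    by rewrite invr_gt0.
  by move=> y yx; apply: contrapT => nGy; apply: noy; exists y.
have : y @ \oo --> x.
  apply: cvg_coordinate => k; apply/cvgrPdist_le => e e0.
  near=> n; rewrite distrC (le_trans ((yP n).1 k _))//.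
    by near: n; exact: nbhs_infty_gt.
  near: n; have := @cvg_harmonic R => /cvgrPdist_le/(_ e e0).
  by apply: filterS => n; rewrite sub0r normrN ger0_norm ?invr_ge0.
have nG : nbhs x G by apply: open_nbhs_nbhs; split.
move=> /(_ G nG) Gy.
have /filter_ex[n Gyn] : \forall n \near \oo, G (y n) by exact: Gy.
exact: (yP n).2 Gyn.
Unshelve. all: by end_near. Qed.

(** The superlevel sets of the rate are increasing unions of sets that depend
    on finitely many coordinates; lower semicontinuity and the compactness
    argument below both rest on this form. *)
Lemma GEM_rate_gtE x (c : R) :
  (c%:E < GEM_rate x)%E <->
  exists n, 1 - \sum_(i < n) coordinate x i < expR (- c).
Proof.
set s := cube_sum (\val x).
have x0 k : 0 <= coordinate x k by have /andP[] := coordinate_itv x k.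
have sle n : ((\sum_(i < n) coordinate x i)%:E <= s)%E.
  rewrite /s /cube_sum -sumEFin -(big_mkord xpredT (fun i => (coordinate x i)%:E)).
  by apply: nneseries_lim_ge => i _ _; rewrite lee_fin; exact: x0.
have s1 : (s <= 1)%E by exact: (set_valP x).
have s0 : (0 <= s)%E by have := sle 0%N; rewrite big_ord0.
have sfin : s = (fine s)%:E by rewrite fineK// ge0_fin_numE// (le_lt_trans s1) ?ltry.
set r := fine s in sfin.
have rle n : \sum_(i < n) coordinate x i <= r by rewrite -lee_fin -sfin.
have r1 : r <= 1 by rewrite -lee_fin -sfin.
have -> : (c%:E < GEM_rate x)%E <-> 1 - r < expR (- c).
  rewrite /GEM_rate -/s sfin lte_fin /=; case: (ltP r 1) => [rlt1|rge1].
    rewrite div1r lte_fin lnV ?posrE ?subr_gt0// ltrNr.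
    by rewrite -ltr_expR lnK// posrE subr_gt0.
  rewrite ltry; split=> // _; rewrite (_ : 1 - r = 0) ?expR_gt0//.
  by apply/eqP; rewrite subr_eq0 eq_le r1 rge1.
split=> [rc|[n nc]]; last by apply: le_lt_trans nc; rewrite lerD2l lerN2.
apply: contrapT => noN.
suff : r <= 1 - expR (- c) by lra.
rewrite -lee_fin -sfin; apply: lime_le.
  by apply: is_cvg_nneseries => i _ _; rewrite lee_fin; exact: x0.
apply: nearW => n; rewrite sumEFin lee_fin big_mkord leNgt; apply/negP => hn.
by apply: noN; exists n; rewrite -/(coordinate x); move: hn; rewrite /coordinate; lra.
Qed.

Lemma GEM_rate_ge0 x : (0 <= GEM_rate x)%E.
Proof.
have s0 : (0 <= cube_sum (\val x))%E.
  apply: nneseries_ge0 => k _ _; rewrite lee_fin.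
  by have /andP[] := coordinate_itv x k.
rewrite /GEM_rate; case: ifPn => // s1; rewrite lee_fin div1r.
move: s0 s1; case: (cube_sum _) => //= r; rewrite lee_fin lte_fin => r0 r1.
by rewrite lnV ?posrE ?subr_gt0// oppr_ge0 ln_le0//; lra.
Qed.

Lemma partial_sum_continuous n :
  continuous (fun x => \sum_(i < n) coordinate x i).
Proof.
apply: (continuous_big (@add_continuous R)) => i _; exact: coordinate_continuous.
Qed.

Lemma GEM_rate_lsc : lower_semicontinuous (@GEM_rate R).
Proof.
move=> x c /GEM_rate_gtE[n nc].
exists [set y | 1 - expR (- c) < \sum_(i < n) coordinate y i]; last first.
  by move=> y /= yc; apply/GEM_rate_gtE; exists n; lra.
apply: open_nbhs_nbhs; split; last by rewrite /=; lra.
by apply: open_comp (@open_gt R _) => y _; exact: partial_sum_continuous.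
Qed.

(** Compactness: were there for each [n] a point of [F] whose [n]-th partial sum
    is at most [1 - expR (- c)], these points would cluster, by Tychonoff, at a
    point [z] of the product. All partial sums of [z] are at most
    [1 - expR (- c)], so [z] lies in the subsimplex, and in [F] since [F] is
    closed, yet its rate is at most [c]. *)
Lemma closed_GEM_rate_gt (F : set (subsimplex R)) (c : R) : closed F ->
  (forall x, F x -> (c%:E < GEM_rate x)%E) ->
  exists n, forall x, F x -> 1 - \sum_(i < n) coordinate x i < expR (- c).
Proof.
move=> cF Fc; apply: contrapT => noN.
have /choice[y yP] : forall n : nat, exists y : subsimplex R,
    F y /\ \sum_(i < n) coordinate y i <= 1 - expR (- c).
  move=> n; apply: contrapT => noy; apply: noN; exists n => y Fy.
  rewrite ltNge; apply/negP => yc; apply: noy; exists y; split => //; lra.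
pose g (n : nat) : prod_topology (fun _ : nat => R) := fun k => coordinate (y n) k.
have := @tychonoff nat (fun=> R) (fun=> `[0, 1]%classic) (fun=> @segment_compact R 0 1).
move=> /(_ (g @ \oo) _)[|z [/= z01 zcl]].
  have : \forall n \near \oo, forall k, `[0, 1]%classic (g n k).
    by near=> n => k /=; rewrite in_itv/=; exact: coordinate_itv.
  by [].
have zcont k : (fun f : prod_topology (fun _ : nat => R) => f k) @ z --> z k.
  exact: (@proj_continuous nat (fun=> R) k z).
have zsum n : \sum_(i < n) z i <= 1 - expR (- c).
  rewrite leNgt; apply/negP => zc.
  have csum : continuous (fun f : prod_topology (fun _ : nat => R) =>
      \sum_(i < n) f i).
    apply: (@continuous_big R 'I_n +%R 0 xpredT (@add_continuous R) _ _
      (fun i (f : prod_topology (fun _ : nat => R)) => f i)) => i _.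
    exact: (@proj_continuous nat (fun=> R) i).
  have zn : nbhs z [set f : prod_topology (fun _ : nat => R) |
      1 - expR (- c) < \sum_(i < n) f i].
    apply: open_nbhs_nbhs; split => //.
    by apply: open_comp (@open_gt R _) => f _; exact: csum.
  have yn : (g @ \oo) [set f | exists2 m, (n <= m)%N & f = g m].
    have : \forall m \near \oo, exists2 m', (n <= m')%N & g m = g m'.
      by near=> m; exists m => //; near: m; exact: nbhs_infty_ge.
    by [].
  have [f [[m nm ->]]] := zcl _ _ yn zn.
  apply/negP; rewrite -leNgt (le_trans _ (yP m).2)// /g.
  rewrite -!(big_mkord xpredT (coordinate (y m))).
  rewrite (big_cat_nat (leq0n n) nm)//= lerDl sumr_ge0// => i _.
  by have /andP[] := coordinate_itv (y m) i.
have zc k : z k \in unit_interval R by apply/mem_set; exact: z01.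
pose z' : cube R := fun k => exist _ (z k) (zc k).
have z'1 : z' \in subsimplex_set R.
  apply/mem_set; rewrite /subsimplex_set/= /cube_sum; apply: lime_le.
    apply: is_cvg_nneseries => i _ _; rewrite lee_fin/=.
    by have := z01 i; rewrite in_itv/= => /andP[].
  apply: nearW => n; rewrite sumEFin lee_fin big_mkord.
  by apply: (le_trans (zsum n)); have := expR_gt0 (- c); lra.
pose x : subsimplex R := exist _ z' z'1.
have [Fx|nFx] := pselect (F x).
  have /GEM_rate_gtE[n] := Fc _ Fx.
  by have := zsum n; rewrite /coordinate/=; lra.
have [n [e e0 nF]] := open_cylinder (closed_openC cF) nFx.
have yF : (g @ \oo) [set f | exists m, f = g m].
  have : \forall m \near \oo, exists m', g m = g m' by near=> m; exists m.
  by [].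
have ze : nbhs z [set f : prod_topology (fun _ : nat => R) |
    forall k : 'I_n, `|f k - z k| <= e].
  apply: (@filter_forall _ _ _ _ (nbhs_filter z)) => k.
  by have /cvgrPdist_le/(_ _ e0) := zcont k; apply: filterS => f; rewrite distrC.
have [f [[m ->]]] := zcl _ _ yF ze.
move=> gz; apply: (nF (y m)); last exact: (yP m).1.
by move=> k kn; exact: (gz (Ordinal kn)).
Unshelve. all: by end_near. Qed.

End Subsimplex.

(** * Stick breaking *)

Section StickBreaking.
Variable R : realType.

Lemma sum_stick_breaking (T : Type) (U : nat -> T -> R) n t :
  1 - \sum_(i < n) stick_breaking U i t = \prod_(i < n) (1 - U i t).
Proof.
elim: n => [|n IH]; first by rewrite !big_ord0 subr0.
by rewrite !big_ord_recr/= -IH opprD addrA IH /stick_breaking mulrBr mulr1.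
Qed.

Lemma ler_dist_prod n (a b : nat -> R) (e : R) :
  (forall i, (i < n)%N -> 0 <= a i <= 1 /\ 0 <= b i <= 1) ->
  (forall i, (i < n)%N -> `|a i - b i| <= e) ->
  `|\prod_(i < n) a i - \prod_(i < n) b i| <= n%:R * e.
Proof.
elim: n => [|n IH] ab01 abe; first by rewrite !big_ord0 subrr normr0 mul0r.
have {}IH := IH (fun i ni => ab01 i (ltnW ni)) (fun i ni => abe i (ltnW ni)).
rewrite !big_ord_recr/=; set A := \prod_(i < n) a i; set B := \prod_(i < n) b i.
have [/andP[a0 a1] _] := ab01 n (ltnSn n).
have B01 : 0 <= B <= 1.
  apply/andP; split.
    by apply: prodr_ge0 => i _; have [_ /andP[]] := ab01 i (ltnW (ltn_ord i)).
  by apply: prodr_ile1 => i _; have [_] := ab01 i (ltnW (ltn_ord i)).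
have -> : A * a n - B * b n = (A - B) * a n + B * (a n - b n) by ring.
rewrite (le_trans (ler_normD _ _))// !normrM -natr1 [leRHS]mulrDl mul1r lerD//.
  by rewrite -[leRHS]mulr1 ler_pM// ger0_norm.
rewrite -[leRHS]mul1r ler_pM// ?abe//.
by case/andP: B01 => ? ?; rewrite ger0_norm.
Qed.

Lemma dist_stick_breaking (T T' : Type) (U : nat -> T -> R) (V : nat -> T' -> R)
    (k : nat) t t' (e : R) :
  (forall i, (i <= k)%N -> 0 <= U i t <= 1 /\ 0 <= V i t' <= 1) ->
  (forall i, (i <= k)%N -> `|U i t - V i t'| <= e) ->
  `|stick_breaking U k t - stick_breaking V k t'| <= k.+1%:R * e.
Proof.
move=> UV01 UVe.
pose a i := if (i < k)%N then 1 - U i t else U i t.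
pose b i := if (i < k)%N then 1 - V i t' else V i t'.
have E (W : nat -> R) : (\prod_(i < k) (1 - W i)) * W k =
    \prod_(i < k.+1) (if (i < k)%N then 1 - W i else W i).
  rewrite big_ord_recr/= ltnn; congr (_ * _).
  by apply: eq_bigr => i _; rewrite ltn_ord.
(* both sides are now products of k + 1 factors in [0, 1] *)
rewrite /stick_breaking (E (U ^~ t)) (E (V ^~ t')).
apply: (@ler_dist_prod _ a b) => i ik; rewrite /a /b.
  have [/andP[? ?] /andP[? ?]] := UV01 _ ik.
  by case: ifP => _; split; apply/andP; split; lra.
case: ifP => _; last exact: UVe.
rewrite (_ : 1 - _ - _ = - (U i t - V i t')); last by ring.
by rewrite normrN UVe.
Qed.

(** The [n]-th stick is broken at the ratio of [x n] to what the previous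
    coordinates have left, which stays positive because the partial sums are
    bounded away from 1. *)
Lemma stick_breaking_surj (s : R) (x : nat -> R) : s < 1 ->
  (forall k, 0 <= x k) -> (forall n, \sum_(i < n) x i <= s) ->
  exists2 v : nat -> R, forall i, 0 <= v i < 1 &
    forall n, stick_breaking (fun i (_ : unit) => v i) n tt = x n.
Proof.
move=> s1 x0 xs; pose S n := \sum_(i < n) x i.
have S1 n : 0 < 1 - S n by have := xs n; rewrite -/(S n); lra.
exists (fun n => x n / (1 - S n)).
  move=> n; rewrite divr_ge0 ?(ltW (S1 n))//= ltr_pdivrMr// mul1r.
  by have := S1 n.+1; rewrite /S big_ord_recr/=; lra.
have P n : \prod_(i < n) (1 - x i / (1 - S i)) = 1 - S n.
  elim: n => [|n IH]; first by rewrite /S !big_ord0 subr0.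
  rewrite big_ord_recr/= IH [in RHS]/S big_ord_recr/= -/(S n).
  by have := S1 n; move: (S n) => y y1; field; rewrite gt_eqF.
by move=> n; rewrite /stick_breaking P mulrC divfK// gt_eqF.
Qed.

(** Measure [- ln (1 - u i)] in steps of length [h] and round down, capping at
    [m] steps. A product below [expR (- (m * h))] needs more than [m] steps in
    total, and rounding loses at most one step per factor. *)
Lemma prod_lt_cover (n m : nat) (h : R) (u : nat -> R) : 0 < h ->
  (forall i, (i < n)%N -> 0 <= u i <= 1) ->
  \prod_(i < n) (1 - u i) < expR (- (m%:R * h)) ->
  exists j : {ffun 'I_n -> 'I_m.+1},
    (m <= n + \sum_(i < n) j i)%N /\
    forall i : 'I_n, 1 - expR (- ((j i)%:R * h)) <= u i <= 1.
Proof.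
move=> h0 u01 produ.
pose Q (i : 'I_n) (k : 'I_m.+1) := 1 - expR (- (k%:R * h)) <= u i.
have Q0 i : Q i ord0.
  by rewrite /Q/= mul0r oppr0 expR0 subrr; have /andP[] := u01 i (ltn_ord i).
pose j := [ffun i => [arg max_(k > ord0 | Q i k) (k : nat)]%N].
have jQ i : Q i (j i) /\ forall k, Q i k -> (k <= j i)%N.
  by rewrite /j ffunE; case: arg_maxnP => // k Qk kmax; split.
exists j; split; last first.
  move=> i; have [Qj _] := jQ i; rewrite [X in X && _]Qj.
  by have /andP[] := u01 i (ltn_ord i).
have [[i ji]|jm] := pselect (exists i, (j i : nat) = m).
  by rewrite (bigD1 i)//= ji addnCA leq_addr.
have jlt i : (j i < m)%N.
  by rewrite ltn_neqAle -ltnS ltn_ord andbT; apply/eqP => ji; apply: jm; exists i.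
(* j i was maximal and is not capped, so one more step is too many *)
have lej (i : 'I_n) : expR (- ((j i).+1%:R * h)) <= 1 - u i.
  rewrite leNgt; apply/negP => lt.
  have : Q i (Ordinal (jlt i : (j i).+1 < m.+1)%N) by rewrite /Q/=; lra.
  by move=> /(jQ i).2/=; rewrite ltnn.
have : expR (- ((n + \sum_(i < n) j i)%:R * h)) < expR (- (m%:R * h)).
  apply: le_lt_trans produ.
  apply: (@le_trans _ _ (\prod_(i < n) expR (- ((j i).+1%:R * h)))).
    rewrite -expR_sum ler_expR sumrN lerN2 -mulr_suml ler_pM2r//.
    rewrite natrD natr_sum -[X in X%:R + _]card_ord -sum1_card natr_sum -big_split/=.
    by apply: ler_sum => i _; rewrite -natr1 addrC.
  by apply: ler_prod => i _; rewrite expR_ge0 lej.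
by rewrite ltr_expR ltrN2 ltr_pM2r// ltr_nat => /ltnW.
Qed.

End StickBreaking.

(** * Independence and union bounds *)

Section Probability.
Variables (R : realType) (d : measure_display) (T : measurableType d).
Variables (P : probability T R).

Lemma le_measure_negligible (A B N : set T) :
  measurable A -> measurable B -> P.-negligible N -> A `<=` N `|` B ->
  (P A <= P B)%E.
Proof.
move=> mA mB [M [mM M0 NM]] ANB.
apply: (@le_trans _ _ (P (M `|` B))).
  apply: le_measure; rewrite ?inE//; first exact: measurableU.
  by move=> t /ANB [/NM|]; [left|right].
by rewrite (le_trans (measureU2 _ _ _))// [X in (X + _)%E]M0 add0e.
Qed.

Lemma measure_big_setU_le (I : Type) (s : seq I) (Q : pred I) (A : I -> set T) :
  (forall i, measurable (A i)) ->
  (P (\big[setU/set0]_(i <- s | Q i) A i) <= \sum_(i <- s | Q i) P (A i))%E.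
Proof.
move=> mA; elim: s => [|i s IH]; first by rewrite !big_nil measure0.
rewrite !big_cons; case: ifP => // _.
apply: (le_trans (measureU2 _ _ _)) => //.
  exact: bigsetU_measurable.
exact: leeD2l.
Qed.

Variable (U : nat -> {RV P >-> R}).
Hypothesis indepU : mutually_independent U.

Lemma mutually_independent_ord n (A : 'I_n -> set R) :
  (forall i, measurable (A i)) ->
  P [set t | forall i : 'I_n, A i (U i t)] = (\prod_(i < n) P (U i @^-1` A i))%E.
Proof.
move=> mA; pose B k := if insub k is Some i then A i else setT.
have BA (i : 'I_n) : B i = A i by rewrite /B valK.
have mB k : measurable (B k) by rewrite /B; case: insub.
have := indepU [fset k in iota 0 n]%fset mB.
rewrite (perm_big (index_iota 0 n)); last first.
  apply: uniq_perm; rewrite ?fset_uniq ?iota_uniq// => k.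
  by rewrite in_fset/= /index_iota subn0.
rewrite big_mkord => indep.
transitivity (\prod_(i < n) P (U i @^-1` B i))%E; last first.
  by apply: eq_bigr => i _; rewrite BA.
rewrite -indep; congr (P _); apply/seteqP; split => [t At k /=|t At i].
  rewrite in_fset/= mem_iota add0n => kn.
  by have := At (Ordinal kn); rewrite -BA.
by rewrite -BA; apply: At; rewrite /= in_fset/= mem_iota add0n ltn_ord.
Qed.

Lemma measurable_ord_event n (A : 'I_n -> set R) :
  (forall i, measurable (A i)) ->
  measurable [set t | forall i : 'I_n, A i (U i t)].
Proof.
move=> mA.
rewrite (_ : [set t | _] = \bigcap_(i in [set: 'I_n]) U i @^-1` A i).
  apply: fin_bigcap_measurable => // i _; exact: measurable_funPTI.
by apply/seteqP; split => t At i; [move=> _; exact: At|exact: At].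
Qed.

End Probability.

(** * Extended reals and exponential rates *)

Section ExtendedReals.
Variable R : realType.

Lemma prode_le n (f : 'I_n -> \bar R) (g : 'I_n -> R) :
  (forall i, 0 <= f i)%E -> (forall i, f i <= (g i)%:E)%E ->
  (\prod_(i < n) f i <= (\prod_(i < n) g i)%:E)%E.
Proof.
move=> f0 fg.
suff : (0 <= \prod_(i < n) f i <= (\prod_(i < n) g i)%:E)%E by case/andP.
elim/big_ind2 : _ => [|x1 x2 y1 y2 /andP[? ?] /andP[? ?]|i _].
- by rewrite lexx lee01.
- by rewrite mule_ge0//= EFinM lee_pmul.
- by rewrite f0 fg.
Qed.

Lemma prode_ge n (f : 'I_n -> \bar R) (g : 'I_n -> R) :
  (forall i, 0 <= g i) -> (forall i, (g i)%:E <= f i)%E ->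
  ((\prod_(i < n) g i)%:E <= \prod_(i < n) f i)%E.
Proof.
move=> g0 gf.
suff : (0 <= \prod_(i < n) g i) /\
  ((\prod_(i < n) g i)%:E <= \prod_(i < n) f i)%E by case.
elim/big_ind2 : _ => [|x1 x2 y1 y2 [? ?] [? ?]|i _].
- by rewrite ler01 lexx.
- by rewrite mulr_ge0//= EFinM lee_pmul ?lee_fin.
- by rewrite g0 gf.
Qed.

Lemma dense_ereal (x y : \bar R) : (x < y)%E -> exists r : R, (x < r%:E < y)%E.
Proof.
move: x y => [x| |] [y| |]//.
- rewrite lte_fin => xy; exists ((x + y) / 2); rewrite !lte_fin; apply/andP; split; lra.
- by move=> _; exists (x + 1); rewrite lte_fin ltry andbT; lra.
- by move=> _; exists (y - 1); rewrite lte_fin ltNyr/=; lra.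
- by move=> _; exists 0; rewrite ltNyr ltry.
Qed.

End ExtendedReals.

Section Asymptotics.
Variable R : realType.
Implicit Types f q : R -> \bar R.

Lemma limf_esup_le f (F : set_system R) (l : \bar R) :
  (\forall t \near F, f t <= l)%E -> (limf_esup f F <= l)%E.
Proof.
move=> fl; rewrite limf_esupE.
apply: (@le_trans _ _ (ereal_sup (f @` [set t | f t <= l]%E))).
  by apply: ereal_inf_lbound; exists [set t | f t <= l]%E.
by apply: ge_ereal_sup => _ [t ft <-].
Qed.

Lemma limf_einf_ge f (F : set_system R) (l : \bar R) :
  (\forall t \near F, l <= f t)%E -> (l <= limf_einf f F)%E.
Proof.
move=> fl; rewrite limf_einfE.
apply: (@le_trans _ _ (ereal_inf (f @` [set t | l <= f t]%E))).
  by apply: le_ereal_inf_tmp => _ [t ft <-].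
by apply: ereal_sup_ubound; exists [set t | l <= f t]%E.
Qed.

Lemma lne_le_homo (x y : \bar R) : (x <= y)%E -> (lne x <= lne y)%E.
Proof.
move=> xy; have [x0|x0] := leP x 0%E; first by rewrite le0_lneNy// leNye.
by rewrite lee_lne ?in_itv/= ?leey ?andbT// ltW// (lt_le_trans x0).
Qed.

(** The constant [C] and the shift from [t] to [t - 1] are negligible on the
    exponential scale, as soon as the rate [L] beats [- c] strictly. *)
Lemma log_rate_le q (C L c : R) : 0 < C -> L < - c ->
  (forall t, (1 <= t)%R -> q t <= (C * expR (L * (t - 1)))%:E)%E ->
  \forall t \near +oo, (t^-1%:E * lne (q t) <= (- c)%:E)%E.
Proof.
move=> C0 Lc qC; near=> t.
have t1 : 1 <= t by near: t; apply: nbhs_pinfty_ge; exact: num_real.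
have t0 : 0 < t by lra.
rewrite lee_pdivrMl// (le_trans (lne_le_homo (qC _ t1)))//.
rewrite lne_EFin ?mulr_gt0 ?expR_gt0// lnM ?posrE ?expR_gt0// expRK -EFinM lee_fin.
have : (ln C - L) / (- c - L) <= t by near: t; apply: nbhs_pinfty_ge; exact: num_real.
rewrite ler_pdivrMr; last by lra.
by nra.
Unshelve. all: by end_near. Qed.

Lemma log_rate_ge q (C L c : R) : 0 < C -> - c < L ->
  (forall t, (1 <= t)%R -> (C * expR (L * (t - 1)))%:E <= q t)%E ->
  \forall t \near +oo, ((- c)%:E <= t^-1%:E * lne (q t))%E.
Proof.
move=> C0 Lc qC; near=> t.
have t1 : 1 <= t by near: t; apply: nbhs_pinfty_ge; exact: num_real.
have t0 : 0 < t by lra.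
rewrite lee_pdivlMl// (le_trans _ (lne_le_homo (qC _ t1)))//.
rewrite lne_EFin ?mulr_gt0 ?expR_gt0// lnM ?posrE ?expR_gt0// expRK -EFinM lee_fin.
have : (L - ln C) / (c + L) <= t by near: t; apply: nbhs_pinfty_ge; exact: num_real.
rewrite ler_pdivrMr; last by lra.
by nra.
Unshelve. all: by end_near. Qed.

End Asymptotics.

(** * The two bounds for GEM laws *)

Lemma measurable_borel_open (X : ptopologicalType) (G : set X) :
  open G -> measurable (G : set (borel X)).
Proof. exact: sub_sigma_algebra. Qed.

Lemma measurable_borel_closed (X : ptopologicalType) (F : set X) :
  closed F -> measurable (F : set (borel X)).
Proof.
move=> cF; rewrite -(setCK F); apply: measurableC.
by apply: measurable_borel_open; exact: closed_openC.
Qed.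

Section GEM.
Variables (R : realType) (alpha : R).
Hypothesis alpha_gt0 : 0 < alpha.
Variable GEM : R -> probability (borel (subsimplex R)) R.
Hypothesis GEM_law : forall theta : R, 0 < theta -> is_GEM theta alpha (GEM theta).

Let beta k : R := k.+1%:R * alpha.

Let beta_gt0 k : 0 < beta k.
Proof. by rewrite mulr_gt0. Qed.

Let a_le1 : 1 - alpha <= 1. Proof. by rewrite gerBl ltW. Qed.

Lemma Beta_integral_lty k :
  (Beta_integral (1 - alpha) (1 + beta k) `[0%R, 1%R] < +oo)%E.
Proof.
have [d [T [P [U [X [_ UB _ _]]]]]] := GEM_law (@ltr01 R).
by have [z _ [-> _]] := Beta_law_normalization (UB k); rewrite ltry.
Qed.

(** With steps of length [h = c / m], each of the finitely many products of tail
    events has at least [m - n] steps in total, and [Beta_law_tail] loses one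
    step per factor: the exponent [m * h = c] drops by [2 * n * h]. *)
Lemma GEM_closed_le n m (c : R) (F : set (subsimplex R)) :
  0 < c -> (0 < m)%N -> closed F ->
  (forall x, F x -> 1 - \sum_(i < n) coordinate x i < expR (- c)) ->
  exists2 C : R, 0 < C & forall theta, 1 <= theta ->
    (GEM theta F <=
      (C * expR ((2 * n%:R / m%:R * c - c) * (theta - 1)))%:E)%E.
Proof.
move=> c0 m0 cF Fc.
have m0' : 0 < m%:R :> R by rewrite ltr0n.
have [h h0 mh] : exists2 h, 0 < h & m%:R * h = c.
  by exists (c / m%:R); [rewrite divr_gt0|rewrite mulrC divfK// gt_eqF].
have /choice[C Cpos] : forall k : nat, exists C : R, 0 < C /\
    forall (theta c : R) (d : measure_display)
      (T : measurableType d) (P : probability T R) (U : {RV P >-> R}),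
    1 <= theta -> 0 <= c -> has_Beta_law (1 - alpha) (theta + beta k) U ->
    (P (U @^-1` `[(1 - expR (- c))%R, 1%R]) <=
     (C * expR ((h - c) * (theta - 1)))%:E)%E.
  move=> k.
  have [C C0 CP] := Beta_law_tail a_le1 (beta_gt0 k) h0 (Beta_integral_lty k).
  by exists C.
pose K := \prod_(i < n) C i.
have K0 : 0 < K by apply: prodr_gt0 => i _; exact: (Cpos i).1.
pose I := {ffun 'I_n -> 'I_m.+1}.
exists (#|{: I}|%:R * K).
  rewrite mulr_gt0// ltr0n; apply/card_gt0P; exists [ffun=> ord0]; exact/isT.
move=> theta theta1.
have [d [T [P [U [X [indep UB XU ->]]]]]] := GEM_law (lt_le_trans ltr01 theta1); last first.
  exact: measurable_borel_closed.
rewrite /distribution/= /pushforward.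
pose A (j : I) (i : 'I_n) : set R := `[1 - expR (- ((j i)%:R * h)), 1]%classic.
pose E (j : I) := [set t | forall i : 'I_n, A j i (U i t)].
pose Q (j : I) := (m <= n + \sum_(i < n) j i)%N.
have mE j : measurable (E j).
  by apply: measurable_ord_event => i; exact: measurable_itv.
(* the exceptional set: X is not the stick-breaking sequence, or some U k is
   outside [0, 1] *)
have := @le_measure_negligible R d T P (X @^-1` F) (\big[setU/set0]_(j | Q j) E j)
  ((~` [set t | forall n, coordinate (X t) n = stick_breaking (fun k => U k : T -> R) n t])
   `|` \bigcup_k (U k @^-1` (~` `[0, 1]))).
move=> /(_ _ _ _ _)/le_trans; apply.
- by apply: measurable_funPTI; exact: measurable_borel_closed.
- exact: bigsetU_measurable.
- apply: negligibleU; first exact: XU.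
  apply: negligible_bigcup => k; apply/negligibleP.
    by apply: measurable_funPTI; apply: measurableC; exact: measurable_itv.
  exact: Beta_law_support (UB k).
- move=> t /= Ft; have [Xt|] := pselect (forall n, coordinate (X t) n =
      stick_breaking (fun k => U k : T -> R) n t); last by left; left.
  have [Ut|nUt] := pselect (forall k, U k t \in `[0, 1]); last first.
    left; right; apply: contrapT => nb; apply: nUt => k.
    by apply: contrapT => Ukt; apply: nb; exists k.
  right.
  have [||j [Qj jU]] := @prod_lt_cover R n m h (fun i => U i t) h0.
  - by move=> i _; have := Ut i; rewrite in_itv.
  - rewrite mh -(sum_stick_breaking (fun k => U k : T -> R) n t).
    by under eq_bigr do rewrite -Xt; exact: Fc.
  by rewrite (bigD1 j Qj)/=; left.
apply: (le_trans (measure_big_setU_le _ _ _ _)) => //.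
apply: (@le_trans _ _ (\sum_(j : I | Q j) (K * expR ((2 * n%:R / m%:R * c - c) * (theta - 1)))%:E)%E).
  apply: lee_sum => j Qj.
  rewrite mutually_independent_ord//; last by move=> i; exact: measurable_itv.
  apply: (@le_trans _ _ (\prod_(i < n) (C i * expR ((h - (j i)%:R * h) * (theta - 1))))%:E).
    apply: prode_le => i //.
    by apply: (Cpos i).2 => //; [rewrite mulr_ge0 ?ler0n ?ltW|exact: UB].
  rewrite lee_fin big_split/= -/K ler_pM2l// -expR_sum ler_expR -mulr_suml.
  rewrite ler_wpM2r ?subr_ge0// sumrB -mulr_suml sumr_const card_ord -[h *+ n]mulr_natl.
  have -> : 2 * n%:R / m%:R * c - c = (2 * n%:R - m%:R) * h.
    by rewrite -mh; field; rewrite gt_eqF.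
  rewrite -mulrBl ler_pM2r// -natr_sum.
  by move: Qj; rewrite /Q -(ler_nat R) natrD; lra.
rewrite sumEFin lee_fin sumr_const -[leLHS]mulr_natl -[leRHS]mulrA ler_wpM2r//.
  by rewrite mulr_ge0 ?expR_ge0 ?ltW.
by rewrite ler_nat max_card.
Qed.

(** The constant [c'] between the rate of [x] and [c] leaves room to enlarge
    the stick ratios [v i] of [x] by [del] and still have
    [\prod_(i < n) (1 - (v i + del)) > expR (- c)]. *)
Lemma GEM_open_ge (G : set (subsimplex R)) (x : subsimplex R) (c : R) :
  open G -> G x -> (GEM_rate x < c%:E)%E ->
  exists2 C : R, 0 < C & exists2 L : R, - c < L &
    forall theta, 1 <= theta ->
    ((C * expR (L * (theta - 1)))%:E <= GEM theta G)%E.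
Proof.
move=> oG Gx xc.
have [n [e e0 nG]] := open_cylinder oG Gx.
have [c' /andP[xc' c'c]] := dense_ereal xc; rewrite lte_fin in c'c.
have xs k : \sum_(i < k) coordinate x i <= 1 - expR (- c').
  rewrite leNgt; apply/negP => xk.
  have : (c'%:E < GEM_rate x)%E by apply/GEM_rate_gtE; exists k; lra.
  by move=> /lt_trans /(_ xc'); rewrite ltxx.
have ec' := expR_gt0 (- c').
have ecc' : expR (- c) < expR (- c') by rewrite ltr_expR ltrN2.
have s1 : 1 - expR (- c') < 1 by lra.
have x0 k : 0 <= coordinate x k by have /andP[] := coordinate_itv x k.
have [v v01 vx] := stick_breaking_surj s1 x0 xs.
have prodv : expR (- c') <= \prod_(i < n) (1 - v i).
  rewrite -(sum_stick_breaking (fun i (_ : unit) => v i) n tt).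
  by under eq_bigr do rewrite vx; have := xs n; lra.
pose g := expR (- c') - expR (- c).
have g0 : 0 < g by rewrite /g subr_gt0.
(* small enough for the cylinder of radius e and for the gap g *)
pose del := Num.min e (g / 2) / n.+1%:R.
have del0 : 0 < del by rewrite divr_gt0// lt_min e0 divr_gt0.
have ndel : n.+1%:R * del = Num.min e (g / 2) by rewrite mulrC divfK.
have dele : n.+1%:R * del <= e by rewrite ndel ge_min lexx.
have delg : n.+1%:R * del < g.
  by rewrite ndel gt_min; apply/orP; right; lra.
have del1 : del <= n.+1%:R * del by rewrite ler_peMl ?ler1n// ltW.
(* a product of numbers in [0, 1] is at most each of its factors *)
have vdel i : (i < n)%N -> v i + del < 1.
  move=> ni; suff : \prod_(i < n) (1 - v i) <= 1 - v i.
    by have := expR_gt0 (- c); rewrite /g in delg; lra.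
  rewrite (bigD1 (Ordinal ni))//= -[leRHS]mulr1 ler_wpM2l//.
    by have := v01 i; lra.
  by apply: prodr_ile1 => j _; have := v01 j; lra.
have prodvdel : expR (- c) < \prod_(i < n) (1 - (v i + del)).
  have := @ler_dist_prod R n (fun i => 1 - v i) (fun i => 1 - (v i + del)) del.
  have h1 i : (i < n)%N -> 0 <= 1 - v i <= 1 /\ 0 <= 1 - (v i + del) <= 1.
    move=> ni; have := v01 i; have := vdel i ni.
    by move=> ? /andP[? ?]; split; apply/andP; split; lra.
  have h2 i : (i < n)%N -> `|1 - v i - (1 - (v i + del))| <= del.
    have -> : 1 - v i - (1 - (v i + del)) = del by ring.
    by rewrite ger0_norm// ltW.
  move=> /(_ h1 h2); rewrite ler_distl => /andP[_ +].
  have : n%:R * del <= n.+1%:R * del by rewrite ler_pM2r// ler_nat.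
  by rewrite /g in delg; lra.
have /choice[C Cpos] : forall k : nat, exists C : R, 0 < C /\ ((k < n)%N ->
    forall (theta : R) (d : measure_display)
      (T : measurableType d) (P : probability T R) (U : {RV P >-> R}),
    1 <= theta -> has_Beta_law (1 - alpha) (theta + beta k) U ->
    ((C * expR (ln (1 - (v k + del)) * (theta - 1)))%:E <=
     P (U @^-1` `[v k, (v k + del)%R]))%E).
  move=> k; have [kn|nk] := ltnP k n; last by exists 1.
  have vk0 : 0 <= v k by have /andP[] := v01 k.
  have vkd : v k < v k + del by rewrite ltrDl.
  have [C C0 CP] := Beta_law_itv_ge a_le1 (beta_gt0 k) vk0 vkd (vdel k kn)
    (Beta_integral_lty k).
  by exists C; split.
exists (\prod_(i < n) C i); first by apply: prodr_gt0 => i _; exact: (Cpos i).1.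
exists (\sum_(i < n) ln (1 - (v i + del))).
  rewrite -ltr_expR expR_sum.
  rewrite [ltRHS](_ : _ = \prod_(i < n) (1 - (v i + del)))//.
  by apply: eq_bigr => i _; rewrite lnK// posrE subr_gt0 vdel.
move=> theta theta1.
have [d [T [P [U [X [indep UB XU ->]]]]]] := GEM_law (lt_le_trans ltr01 theta1); last first.
  exact: measurable_borel_open.
rewrite /distribution/= /pushforward.
pose A (i : 'I_n) : set R := `[v i, v i + del]%classic.
pose E := [set t | forall i : 'I_n, A i (U i t)].
apply: (@le_trans _ _ (P E)).
  rewrite mutually_independent_ord//; last by move=> i; exact: measurable_itv.
  rewrite mulr_suml expR_sum -big_split/=; apply: prode_ge => i.
    by rewrite mulr_ge0 ?expR_ge0// ltW// (Cpos i).1.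
  by apply: (Cpos i).2 => //; exact: UB.
apply: (@le_measure_negligible R d T P _ _
  (~` [set t | forall n, coordinate (X t) n =
                 stick_breaking (fun k => U k : T -> R) n t])) => //.
- by apply: measurable_ord_event => i; exact: measurable_itv.
- by apply: measurable_funPTI; exact: measurable_borel_open.
move=> t Et; have [Xt|] := pselect (forall n, coordinate (X t) n =
      stick_breaking (fun k => U k : T -> R) n t); last by left.
right; apply: nG => k kn; rewrite Xt -vx.
have UA i : (i <= k)%N -> v i <= U i t <= v i + del.
  by move=> ik; have := Et (Ordinal (leq_ltn_trans ik kn)); rewrite /A/= in_itv.
apply: (@le_trans _ _ (k.+1%:R * del)).
  apply: dist_stick_breaking => i ik; have /andP[? ?] := UA i ik.
    have /andP[? ?] := v01 i; have := vdel i (leq_ltn_trans ik kn) => ?.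
    by split; apply/andP; split; lra.
  by rewrite ger0_norm ?subr_ge0//; lra.
by apply: le_trans dele; rewrite ler_pM2r// ler_nat ltnW.
Qed.

End GEM.

Theorem theorem2p2 (R : realType) (alpha : R)
    (alpha_gt0 : 0 < alpha) (alpha_lt1 : alpha < 1)
    (GEM : R -> probability (borel (subsimplex R)) R)
    (GEM_law : forall theta : R, 0 < theta -> is_GEM theta alpha (GEM theta)) :
  LDP GEM (@GEM_rate R).
Proof.
split.
- exact: GEM_rate_ge0.
- exact: GEM_rate_lsc.
- move=> F cF; rewrite leeNr leNgt; apply/negP => /dense_ereal[c /andP[lc cI]].
  (* the room between c and c' absorbs the loss 2 * n / m * c' *)
  have [c' /andP[cc' c'I]] := dense_ereal cI; rewrite lte_fin in cc'.
  suff : \forall theta \near +oo,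
      (theta^-1%:E * lne (GEM theta F) <= (- c)%:E)%E.
    by move=> /limf_esup_le; rewrite leNgt EFinN lteNl lc.
  have [c0|c0] := ltP c 0.
    near=> theta.
    apply: (@le_trans _ _ 0%E); last by rewrite lee_fin; lra.
    have t0 : 0 < theta by near: theta; apply: nbhs_pinfty_gt; exact: num_real.
    apply: mule_ge0_le0; first by rewrite lee_fin invr_ge0 ltW.
    by rewrite lne_le0; apply: probability_le1; exact: measurable_borel_closed.
  have Fc' x : F x -> (c'%:E < GEM_rate x)%E.
    by move=> Fx; apply: (lt_le_trans c'I); apply: ereal_inf_lbound; exists x.
  have [n Fn] := closed_GEM_rate_gt cF Fc'.
  have c'0 : 0 < c' by lra.
  pose m := (Num.truncn (2 * n%:R * c' / (c' - c))).+1.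
  have nm : 2 * n%:R * c' / (c' - c) < m%:R by exact: truncnS_gt.
  have [C C0 CF] := GEM_closed_le alpha_gt0 GEM_law c'0
    (ltn0Sn _ : (0 < m)%N) cF Fn.
  apply: (log_rate_le C0 _ CF).
  rewrite ltr_pdivrMr in nm; last by lra.
  suff : 2 * n%:R / m%:R * c' < c' - c by lra.
  by rewrite mulrAC ltr_pdivrMr ?ltr0n// [ltRHS]mulrC.
- move=> G oG; rewrite leeNl; apply: le_ereal_inf_tmp => _ [x Gx <-].
  rewrite leNgt; apply/negP => /dense_ereal[c /andP[xc cl]].
  have [C C0 [L cL CG]] := GEM_open_ge alpha_gt0 GEM_law oG Gx xc.
  have /limf_einf_ge := log_rate_ge C0 cL CG.
  by rewrite EFinN leeNl leNgt cl.
Unshelve. all: by end_near. Qed.
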